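(* Let $g,\ell,k$ be positive integers and let $p_1,\ldots,p_k$ be such that each $p_i\in\mathbb{R}^{\nu_i\times\ell}\langle x,x^*\rangle$ for some $\nu_i\in\mathbb{N}$. For $\nu\in\mathbb{N}$ define $$J_\nu:=\mathbb{R}^{\nu\times 1}\,\sqrt[\mathrm{rr}]{\sum_{i=1}^k\mathbb{R}^{1\times\nu_i}\langle x,x^*\rangle\, p_i}.$$ Let $q\in\mathbb{R}^{\nu\times\ell}\langle x,x^*\rangle$. Then $q(X)v=0$ for all $(X,v)\in\bigcup_{n\in\mathbb{N}}(\mathbb{R}^{n\times n})^g\times\mathbb{R}^{\ell n}$ such that $p_1(X)v=0,\ldots,p_k(X)v=0$ if and only if $q\in J_\nu$. Consequently, if the left module $\sum_{i=1}^k\mathbb{R}^{1\times\nu_i}\langle x,x^*\rangle\, p_i$ is real, and if $q(X)v=0$ whenever $p_1(X)v=0,\ldots,p_k(X)v=0$, then $q$ is of the form $$q=r_1p_1+\cdots+r_kp_k,$$ where each $r_i\in\mathbb{R}^{\nu\times\nu_i}\langle x,x^*\rangle$.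
   Context: $\langle x,x^*\rangle$ is the free monoid on the $2g$ letters $x_1,\ldots,x_g,x_1^*,\ldots,x_g^*$ (the empty word is the identity $1$), and $\mathbb{R}\langle x,x^*\rangle$ is the free $\mathbb{R}$-algebra it spans (non-commutative polynomials). The involution $*$ on $\mathbb{R}\langle x,x^*\rangle$ is the linear map exchanging $x_i$ and $x_i^*$ with $(pq)^*=q^*p^*$. $\mathbb{R}^{\nu\times\ell}\langle x,x^*\rangle=\mathbb{R}^{\nu\times\ell}\otimes\mathbb{R}\langle x,x^*\rangle$ is the space of $\nu\times\ell$ matrices with entries in $\mathbb{R}\langle x,x^*\rangle$; its involution is $(\sum_w A_w\otimes w)^*=\sum_w A_w^*\otimes w^*\in\mathbb{R}^{\ell\times\nu}\langle x,x^*\rangle$, where $A^*$ is the transpose of the real matrix $A$. Evaluation: for $X=(X_1,\ldots,X_g)\in(\mathbb{R}^{n\times n})^g$ and a word $w$, $w(X)$ is obtained by replacing $x_i$ by $X_i$, $x_i^*$ by the transpose $X_i^*$, and the empty word by the identity; for $p=\sum_w A_w\otimes w\in\mathbb{R}^{\nu\times\ell}\langle x,x^*\rangle$, $p(X)=\sum_w A_w\otimes w(X)\in\mathbb{R}^{\nu n\times\ell n}$ (Kronecker product). For sets $A,B$ of matrices of compatible sizes, $AB$ is the linear span of $\{ab\mid a\in A,b\in B\}$, $A^*=\{a^*\mid a\in A\}$, and $Bp:=B\{p\}$. ''Left module'' means a left $\mathbb{R}\langle x,x^*\rangle$-submodule of $\mathbb{R}^{1\times\ell}\langle x,x^*\rangle$.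 For a left module $I$, $\mathbb{R}^{\nu\times1}I$ is the space of $\nu\times\ell$ matrices all of whose rows lie in $I$. A left module $I\subseteq\mathbb{R}^{1\times\ell}\langle x,x^*\rangle$ is real if whenever a finite sum $\sum_i p_i^*p_i$ with $p_i\in\mathbb{R}^{1\times\ell}\langle x,x^*\rangle$ lies in $\mathbb{R}^{\ell\times1}I+I^*\mathbb{R}^{1\times\ell}$, then each $p_i\in I$. The real radical $\sqrt[\mathrm{rr}]{I}$ of a left module $I$ is the intersection of all real left modules containing $I$, i.e. the smallest real left module containing $I$. *)

(* Defs.v *)
From mathcomp Require Import all_boot all_algebra.
From mathcomp Require Import classical_sets reals.
From mathcomp.finmap Require Import finmap.
From mathcomp.multinomials Require Import monalg.
From mathcomp.real_closed Require Import mxtens.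

Set Implicit Arguments.
Unset Strict Implicit.
Unset Printing Implicit Defensive.

Import GRing.Theory.
Local Open Scope classical_set_scope.
Local Open Scope ring_scope.

(* The letter x_i is encoded as (i, false) and the letter x_i^* as (i, true). *)
Notation word g := {fmonom ('I_g * bool)%type}.
Notation ncpoly R g := {malg R[word g]}.

Definition word_star (g : nat) (w : word g) : word g :=
  FMonom (rev [seq (c.1, ~~ c.2) | c <- w : seq ('I_g * bool)]).

Definition ncpoly_star (R : realType) (g : nat) (p : ncpoly R g) : ncpoly R g :=
  \sum_(w <- msupp p) << p@_w *g word_star w >>.

(* The identification of R^{a x b} (x) R<x,x^*> with matrices over R<x,x^*>
   turns (sum_w A_w (x) w)^* = sum_w A_w^T (x) w^* into the transpose with the
   involution applied to every entry. *)
Definition ncmx_star (R : realType) (g a b : nat) (p : 'M[ncpoly R g]_(a, b)) :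
    'M[ncpoly R g]_(b, a) :=
  map_mx (@ncpoly_star R g) p^T.

Definition word_eval (R : realType) (g n : nat) (X : 'I_g -> 'M[R]_n)
    (w : word g) : 'M[R]_n :=
  \big[mulmx/1%:M]_(c <- (w : seq ('I_g * bool)))
    (if c.2 then (X c.1)^T else X c.1).

Definition ncmx_coef (R : realType) (g a b : nat) (p : 'M[ncpoly R g]_(a, b))
    (w : word g) : 'M[R]_(a, b) :=
  \matrix_(i, j) (p i j)@_w.

Definition ncmx_supp (R : realType) (g a b : nat) (p : 'M[ncpoly R g]_(a, b)) :
    {fset word g} :=
  \big[fsetU/fset0]_(i < a) \big[fsetU/fset0]_(j < b) msupp (p i j).

Definition ncmx_eval (R : realType) (g n a b : nat) (X : 'I_g -> 'M[R]_n)
    (p : 'M[ncpoly R g]_(a, b)) : 'M[R]_(a * n, b * n) :=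
  \sum_(w <- ncmx_supp p) tensmx (ncmx_coef p w) (word_eval X w).

Definition ncmx_const (R : realType) (g a b : nat) (A : 'M[R]_(a, b)) :
    'M[ncpoly R g]_(a, b) :=
  map_mx (fun c : R => c%:MP) A.

(* The linear span is over R, not over R<x,x^*>. *)
Definition real_span (R : realType) (g a b : nat) (S : set 'M[ncpoly R g]_(a, b)) :
    set 'M[ncpoly R g]_(a, b) :=
  [set M | exists (m : nat) (c : 'I_m -> R) (s : 'I_m -> 'M[ncpoly R g]_(a, b)),
     (forall i, S (s i)) /\ M = \sum_(i < m) map_mx ( *:%R (c i)) (s i)].

Definition setmulmx (R : realType) (g a b c : nat)
    (A : set 'M[ncpoly R g]_(a, b)) (B : set 'M[ncpoly R g]_(b, c)) :
    set 'M[ncpoly R g]_(a, c) :=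
  real_span [set x *m y | x in A & y in B].

Definition left_module (R : realType) (g l : nat)
    (I : set 'rV[ncpoly R g]_l) : Prop :=
  [/\ I 0, (forall u v, I u -> I v -> I (u + v))
    & (forall (a : ncpoly R g) u, I u -> I (a *: u))].

(* When I is a left module this is R^{nu x 1} I: an R-combination of columns
   times elements of I is exactly a matrix whose rows lie in I. *)
Definition rows_in (R : realType) (g l nu : nat) (I : set 'rV[ncpoly R g]_l) :
    set 'M[ncpoly R g]_(nu, l) :=
  [set M | forall i, I (row i M)].

(* R^{l x 1} I + I^* R^{1 x l}, real row vectors being constant polynomials *)
Definition sym_part (R : realType) (g l : nat) (I : set 'rV[ncpoly R g]_l) :
    set 'M[ncpoly R g]_l :=
  [set M + N | M in rows_in I
             & N in setmulmx (@ncmx_star R g 1 l @` I)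
                             (range (@ncmx_const R g 1 l))].

Definition real_module (R : realType) (g l : nat)
    (I : set 'rV[ncpoly R g]_l) : Prop :=
  left_module I /\
  forall (m : nat) (s : 'I_m -> 'rV[ncpoly R g]_l),
    sym_part I (\sum_(i < m) ncmx_star (s i) *m s i) -> forall i, I (s i).

Definition real_radical (R : realType) (g l : nat) (I : set 'rV[ncpoly R g]_l) :
    set 'rV[ncpoly R g]_l :=
  \bigcap_(J in [set J | real_module J /\ I `<=` J]) J.

(* sum_i R^{1 x nu_i}<x,x^*> p_i *)
Definition gen_module (R : realType) (g l k : nat) (nus : 'I_k -> nat)
    (p : forall i : 'I_k, 'M[ncpoly R g]_(nus i, l)) :
    set 'rV[ncpoly R g]_l :=
  [set u | exists m : 'I_k -> 'rV[ncpoly R g]_l,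
     (forall i, setmulmx [set: 'rV[ncpoly R g]_(nus i)] [set p i] (m i)) /\
     u = \sum_(i < k) m i].

(* Main.v *)
(** Soundness: for fixed [X] and [v] the rows [u] with [u(X)v = 0] form a real left
module, because [v^T (sum_i s_i^* s_i)(X) v] is the sum of the [|s_i(X)v|^2].

Completeness: let [I] be a real left module and let [V_d] be the space of rows of degree
at most [d].  The cone of sums of squares of elements of [V_d] is the image of the positive
semidefinite matrices; realness says that on [V_d / (V_d cap I)] it meets the finite
dimensional space of forms lying in [R^(l x 1) I + I^* R^(1 x l)] only in [0].  By
compactness a linear functional separates the two, which amounts to a positive definite
inner product on [V_d / (V_d cap I)] for which multiplication by [x_i] and by [x_i^*],
defined on rows of degree less than [d], are formally adjoint.  Such a pair extends to a
matrix [X_i] and its transpose, and with [v] the classes of the unit rows one gets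
[u(X)v = 0] if and only if [u] is in [I], for every [u] in [V_d]. *)

From HB Require Import structures.
Require Import Defs.
From mathcomp Require Import all_boot all_order all_algebra.
From mathcomp Require Import zify ring lra.
From mathcomp Require Import boolp classical_sets reals.
From mathcomp Require topology normedtype derive.

Set Implicit Arguments.
Unset Strict Implicit.
Unset Printing Implicit Defensive.

Import Order.TTheory GRing.Theory Num.Def Num.Theory.
Local Open Scope classical_set_scope.
Local Open Scope ring_scope.

(** * Separation of a subspace from the positive semidefinite cone *)

Section compact_separation.
Import topology normedtype derive.
Import numFieldNormedType.Exports.

Lemma linform_continuous (R : realType) n (a : 'cV[R]_n) :
  continuous (fun x : 'rV[R]_n => (x *m a) 0 0).
Proof.
under eq_fun do rewrite mxE.
apply: continuous_big => [|i _]; first exact: add_continuous.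
move=> x; apply: (@continuousM R 'rV[R]_n (fun y => y 0 i) (fun=> a i 0)).
  exact: coord_continuous.
exact: cst_continuous.
Qed.

(** An intersection of closed half-spaces is closed and convex, and the bound makes it compact. Its
    image under [Q] is then compact, convex and misses 0, so the point of that image nearest to 0
    separates it from 0. *)
Lemma halfspaces_separation (R : realType) n m (F : 'cV[R]_n -> R -> Prop)
    (Q : 'M[R]_(n, m)) (S := [set x : 'rV[R]_n | forall a b, F a b -> b <= (x *m a) 0 0])
    (x0 : 'rV[R]_n) :
  S x0 -> (forall x, S x -> forall i, `|x 0 i| <= 1) ->
  (forall x, S x -> x *m Q != 0) ->
  exists y : 'cV[R]_m, forall x, S x -> 0 < (x *m Q *m y) 0 0.
Proof.
move=> Sx0 bS QS.
pose nrm (z : 'rV[R]_m) := (z *m z^T) 0 0.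
have clS : closed S.
  have -> : S = \bigcap_(ab in [set ab : 'cV[R]_n * R | F ab.1 ab.2])
      ((fun x : 'rV[R]_n => (x *m ab.1) 0 0) @^-1` [set r | ab.2 <= r]).
    apply/seteqP; split => x /= Sx; first by move=> [a b] /= /Sx.
    by move=> a b Fab; exact: (Sx (a, b)).
  apply: closed_bigI => ab _; apply: preimage_closed => [x|]; last exact: closed_ge.
  by move=> ?; exact: linform_continuous.
have coS : compact S.
  apply: bounded_closed_compact => //; exists 1; split; first exact: real1.
  move=> r r1 x Sx; apply: ltW; apply: le_lt_trans r1.
  rewrite /normr /= mx_normrE; apply/bigmax_leP; split => // -[i j] _ /=.
  by rewrite (ord1 i); exact: bS.
have cf : continuous (fun x : 'rV[R]_n => nrm (x *m Q)).
  rewrite /nrm; under eq_fun do rewrite mxE.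
  apply: continuous_big => [|i _]; first exact: add_continuous.
  have C : forall x, {for x, continuous (fun y : 'rV[R]_n => (y *m Q) 0 i)}.
    have -> : (fun y : 'rV[R]_n => (y *m Q) 0 i) = (fun y => (y *m col i Q) 0 0).
      by apply/funext => y; rewrite !mxE; apply: eq_bigr => j _; rewrite !mxE.
    exact: linform_continuous.
  under eq_fun do rewrite [_^T _ _]mxE.
  by move=> x; exact: (continuousM (C x) (C x)).
(* The minimizer [c] of [|x Q|] on the convex set [S] gives the separating vector: along the
   segment from [c] to [x] the norm cannot decrease. *)
have [c] : exists2 c, c \in S & forall t, t \in S -> nrm (c *m Q) <= nrm (t *m Q).
  apply: EVT_min_rV => //; first by exists x0.
  exact: continuous_subspaceT.
rewrite inE => Sc minc.
exists (c *m Q)^T => x Sx.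
have nrm_ge0 z : 0 <= nrm z.
  by rewrite /nrm mxE sumr_ge0 // => i _; rewrite mxE -expr2 sqr_ge0.
have nrm_eq0 z : nrm z = 0 -> z = 0.
  rewrite /nrm mxE => /psumr_eq0P; move=> H; apply/rowP => i.
  have /H/(_ i isT)/eqP : forall i, true -> 0 <= z 0 i * z^T i 0.
    by move=> j _; rewrite mxE -expr2 sqr_ge0.
  by rewrite mxE mulf_eq0 orbb => /eqP ->; rewrite mxE.
have convS t : 0 <= t <= 1 -> S (c + t *: (x - c)).
  move=> t01 a b Fab; have := Sc _ _ Fab; have := Sx _ _ Fab.
  have -> : ((c + t *: (x - c)) *m a) 0 0 =
     (c *m a) 0 0 + t * ((x *m a) 0 0 - (c *m a) 0 0).
    by rewrite mulmxDl -scalemxAl mulmxBl !mxE.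
  nra.
set y := c *m Q; set z := x *m Q - y.
have expand t : nrm ((c + t *: (x - c)) *m Q) =
   nrm y + 2 * t * (z *m y^T) 0 0 + t ^+ 2 * nrm z.
  have -> : (c + t *: (x - c)) *m Q = y + t *: z.
    by rewrite mulmxDl -scalemxAl mulmxBl.
  have dotC : (y *m z^T) 0 0 = (z *m y^T) 0 0.
    by rewrite -[in LHS](trmxK (y *m z^T)) trmx_mul trmxK mxE.
  have trE : (y + t *: z)^T = y^T + t *: z^T by rewrite linearD linearZ.
  rewrite /nrm trE mulmxDl !mulmxDr -!scalemxAl -!scalemxAr scalerA.
  move: dotC; move: (y *m z^T) (z *m y^T) (z *m z^T) (y *m y^T) => A B C D.
  rewrite !mxE => ->; ring.
have ge0 : 0 <= (z *m y^T) 0 0.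
  rewrite leNgt; apply/negP => lt0.
  set w := (z *m y^T) 0 0 in lt0 expand.
  have nz : 0 < nrm z - w by rewrite subr_gt0 (lt_le_trans lt0).
  have hw : nrm z - w \is a GRing.unit by rewrite unitfE gt_eqF.
  (* This [t] lies in (0, 1], and moving by it changes the squared norm by [t * w * (1 + t)], which
     is negative: a contradiction with the minimality of [c]. *)
  pose t := - w / (nrm z - w).
  have tE : t * (nrm z - w) = - w by rewrite /t divrK.
  have t0 : 0 < t by rewrite /t divr_gt0 ?oppr_gt0.
  have t1 : t <= 1 by rewrite /t ler_pdivrMr // mul1r; have := nrm_ge0 z; lra.
  have t01 : 0 <= t <= 1 by rewrite t1 ltW.
  have /minc : c + t *: (x - c) \in S by rewrite inE; exact: convS.
  rewrite expand -/y.
  have tn : t * nrm z = - w + t * w by rewrite -tE; ring.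
  have -> : t ^+ 2 * nrm z = t * (- w + t * w) by rewrite -tn; ring.
  have := nrm_ge0 z; nra.
have y0 : 0 < nrm y.
  rewrite lt_def nrm_ge0 andbT; apply: contraNneq (QS _ Sc) => /nrm_eq0 E.
  by rewrite -/y E.
suff -> : (x *m Q *m y^T) 0 0 = (z *m y^T) 0 0 + nrm y by rewrite ltr_wpDl.
by rewrite /z /nrm mulmxBl !mxE subrK.
Unshelve. all: by end_near. Qed.

End compact_separation.

(** * Gram matrices and the positive semidefinite cone *)

Lemma mxtrace_gramE (R : realDomainType) m n (A : 'M[R]_(m, n)) :
  \tr (A *m A^T) = \sum_i \sum_j A i j ^+ 2.
Proof.
by apply: eq_bigr => i _; rewrite mxE; apply: eq_bigr => j _; rewrite mxE expr2.
Qed.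

Lemma mxtrace_gram_ge0 (R : realDomainType) m n (A : 'M[R]_(m, n)) :
  0 <= \tr (A *m A^T).
Proof.
by rewrite mxtrace_gramE sumr_ge0 // => i _; rewrite sumr_ge0 // => j _; exact: sqr_ge0.
Qed.

Lemma mxtrace_gram_eq0 (R : realDomainType) m n (A : 'M[R]_(m, n)) :
  \tr (A *m A^T) = 0 -> A = 0.
Proof.
rewrite mxtrace_gramE => /psumr_eq0P A0; apply/matrixP => i j; rewrite mxE.
have /psumr_eq0P Ai0 := A0 (fun i _ => sumr_ge0 _ (fun j _ => sqr_ge0 (A i j))) i isT.
by apply/eqP; rewrite -sqrf_eq0 Ai0 // => *; exact: sqr_ge0.
Qed.

Lemma mxtrace_mx11 (R : pzRingType) (A : 'M[R]_1) : \tr A = A 0 0.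
Proof. by rewrite /mxtrace big_ord1. Qed.

Lemma mx11_tr (R : pzRingType) (A : 'M[R]_1) : A^T = A.
Proof. by apply/matrixP => i j; rewrite mxE !ord1. Qed.

Definition psd (R : realDomainType) n (G : 'M[R]_n) :=
  G^T = G /\ forall c : 'rV[R]_n, 0 <= (c *m G *m c^T) 0 0.

(** Cholesky factorization by induction on the size: if the corner [a] is nonzero, its Schur
    complement is again positive semidefinite; if [a] is 0, so is the rest of its row. *)
Lemma psd_factor (R : rcfType) n (G : 'M[R]_n) :
  psd G -> exists A : 'M[R]_n, G = A^T *m A.
Proof.
elim: n => [|n IHn] in G *.
  by exists 0; apply/matrixP => -[].
move=> -[symG posG]; rewrite -[n.+1]/(1 + n)%N in G symG posG *.
pose a := G 0 0; pose b : 'rV_n := ursubmx G; pose D : 'M_n := drsubmx G.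
have GE : G = block_mx a%:M b b^T D.
  rewrite -[LHS]submxK -[in dlsubmx G]symG -trmx_ursub; congr block_mx.
  by rewrite [ulsubmx G]mx11_scalar !mxE; congr (G _ _)%:M; apply: val_inj.
have symD : D^T = D by rewrite /D trmx_drsub symG.
have quad s (c : 'rV_n) : 0 <= s ^+ 2 * a + 2 * s * (b *m c^T) 0 0 + (c *m D *m c^T) 0 0.
  have := posG (row_mx s%:M c); rewrite GE tr_row_mx mul_row_block mul_row_col.
  rewrite !mulmxDl tr_scalar_mx !mul_scalar_mx !mul_mx_scalar scale_scalar_mx.
  have -> : c *m b^T = b *m c^T by rewrite -[LHS]mx11_tr trmx_mul trmxK.
  rewrite -scalemxAl; move: (b *m c^T) (c *m D *m c^T) => X Y.
  rewrite !mxE /= => H; apply: le_trans H _; rewrite le_eqVlt; apply/orP; left.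
  apply/eqP; ring.
have a_ge0 : 0 <= a.
  have := quad 1 0; rewrite trmx0 !mulmx0 !mxE; lra.
have [a0|a_neq0] := eqVneq a 0.
  have bc0 (c : 'rV_n) : (b *m c^T) 0 0 = 0.
    set t := _ 0 0; have [//|t0] := eqVneq t 0; set d := (c *m D *m c^T) 0 0.
    (* With [a = 0] the form is affine in [s], and this [s] gives it the value -1. *)
    have := quad (- ((d + 1) / (2 * t))) c; rewrite a0 -/t -/d mulr0 add0r.
    have -> : 2 * - ((d + 1) / (2 * t)) * t = - (d + 1) by field.
    lra.
  have b0 : b = 0.
    apply: mxtrace_gram_eq0; rewrite mxtrace_mx11; exact: bc0.
  have /IHn [A DE] : psd D.
    split=> // c; have := quad 0 c.
    by rewrite expr2 !mulr0 !mul0r !add0r.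
  exists (block_mx 0 0 0 A); rewrite GE a0 b0 tr_block_mx mulmx_block.
  by rewrite !trmx0 !mul0mx !mulmx0 !addr0 add0r -DE raddf0.
have sa : Num.sqrt a != 0 by rewrite gt_eqF // sqrtr_gt0 lt_def a_neq0.
have sa2 : Num.sqrt a * Num.sqrt a = a by rewrite -expr2 sqr_sqrtr.
have /IHn [A DE] : psd (D - a^-1 *: (b^T *m b)).
  split=> [|c]; first by rewrite linearB linearZ /= trmx_mul trmxK symD.
  (* The choice [- (t / a)] minimizes the form in [s], and the minimum is the value of the Schur
     complement at [c]. *)
  set t : R := (b *m c^T) 0 0; have := quad (- (t / a)) c; rewrite -/t.
  have -> : (c *m (D - a^-1 *: (b^T *m b)) *m c^T) 0 0 =
      (c *m D *m c^T) 0 0 - a^-1 * t ^+ 2.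
    rewrite mulmxBr mulmxBl -scalemxAr -scalemxAl mulmxA -[_ *m b^T *m b *m _]mulmxA.
    have -> : c *m b^T = t%:M.
      by rewrite -[LHS]mx11_tr trmx_mul trmxK [LHS]mx11_scalar.
    by move: (c *m D *m c^T) => Y; rewrite mul_scalar_mx [b *m _]mx11_scalar -/t
      scale_scalar_mx !mxE mulr1n expr2.
  by move=> H; apply: le_trans H _; rewrite le_eqVlt; apply/orP; left; apply/eqP; field.
exists (block_mx (Num.sqrt a)%:M ((Num.sqrt a)^-1 *: b) 0 A).
have trE : ((Num.sqrt a)^-1 *: b)^T = (Num.sqrt a)^-1 *: b^T by rewrite linearZ.
rewrite GE tr_block_mx trE mulmx_block !trmx0 tr_scalar_mx !mul0mx !mulmx0 !addr0.
rewrite -scalar_mxM sa2 !mul_scalar_mx mul_mx_scalar !scalerA.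
rewrite mulfV // !scale1r -DE -scalemxAl -scalemxAr scalerA.
by rewrite -invfM sa2 addrC subrK.
Qed.

(** Vectors of [P] outside the current row space are adjoined one at a time. Each raises the rank,
    and [k] bounds the codimension still available. *)
Lemma subspace_row_space (F : fieldType) n (P : 'rV[F]_n -> Prop) :
  P 0 -> (forall a u v, P u -> P v -> P (a *: u + v)) ->
  exists M : 'M[F]_n, forall u, P u <-> (u <= M)%MS.
Proof.
move=> P0 Plin.
suff grow k (M : 'M[F]_n) : (n - \rank M <= k)%N -> (forall u, (u <= M)%MS -> P u) ->
    exists M' : 'M[F]_n, forall u, P u <-> (u <= M')%MS.
  apply: (grow n 0); first by rewrite leq_subr.
  by move=> u; rewrite submx0 => /eqP ->.
elim: k M => [|k IHk] M rM MP.
all: have [PM|/existsNP[u /not_implyP[Pu /negP uM]]] :=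
  pselect (forall u, P u -> (u <= M)%MS).
all: try by exists M => u; split; [exact: PM | exact: MP].
  have fM : row_full M by rewrite /row_full eqn_leq rank_leq_col -subn_eq0 -leqn0.
  by move: uM; rewrite submx_full.
apply: (IHk (M + u)%MS).
  have : (M < M + u)%MS.
    by rewrite ltmxE addsmxSl /=; apply: contra uM; rewrite addsmx_sub => /andP[].
  by move=> /rank_ltmx; move: rM; rewrite !leq_subLR; lia.
move=> w /sub_addsmxP[[x y] /= ->].
rewrite addrC [y]mx11_scalar mul_scalar_mx; apply: Plin => //.
exact/MP/submxMl.
Qed.

Lemma mxvec_dot (R : comPzRingType) m n (A B : 'M[R]_(m, n)) :
  (mxvec A *m (mxvec B)^T) 0 0 = \tr (A *m B^T).
Proof.
rewrite mxE (reindex _ (curry_mxvec_bij m n)) /=.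
transitivity (\sum_i \sum_j A i j * B i j).
  by rewrite pair_bigA; apply: eq_bigr => -[i j] _ /=; rewrite mxE !mxvecE.
by apply: eq_bigr => i _; rewrite mxE; apply: eq_bigr => j _; rewrite mxE.
Qed.

(** The last hypothesis says that [U] meets the positive semidefinite cone only in 0. Hence [U]
    misses the trace-one slice of the cone, which is compact and convex. The separating functional,
    once symmetrized, is the trace pairing with a positive definite [B] that vanishes on [U], and
    [A] is a factor of [B]. *)
Lemma psd_separation (R : realType) r (U : 'M[R]_r -> Prop) :
  U 0 -> (forall a G H, U G -> U H -> U (a *: G + H)) ->
  (forall G, U G -> U G^T) -> (forall A : 'M[R]_r, U (A^T *m A) -> A = 0) ->
  exists A : 'M[R]_r, A \in unitmx /\ forall G, U G -> \tr (A^T *m G *m A) = 0.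
Proof.
(* In size 0 the trace-one slice is empty and every trace is 0. *)
case: r U => [|r] U U0 Ulin Utr Upsd.
  by exists 1%:M; split; [exact: unitmx1 | move=> G _; rewrite /mxtrace big_ord0].
have [||M UM] := @subspace_row_space R _ (fun x => U (vec_mx x)).
- by rewrite linear0.
- by move=> a u v Uu Uv; rewrite linearP; exact: Ulin.
(* The trace-one slice as an intersection of half-spaces: rank-one tests give positivity,
   antisymmetric tests give symmetry, and the last two give trace at least 1 and at most 1. *)
pose F (a : 'cV[R]_(r.+1 * r.+1)) (b : R) :=
  [\/ exists2 c : 'rV[R]_r.+1, a = (mxvec (c^T *m c))^T & b = 0,
      exists2 A : 'M[R]_r.+1, A^T = - A & a = (mxvec A)^T /\ b = 0,
      a = (mxvec 1%:M)^T /\ b = 1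
    | a = (mxvec (- 1%:M))^T /\ b = - 1].
pose S := [set x : 'rV[R]__ | forall a b, F a b -> b <= (x *m a) 0 0].
have SE G : S (mxvec G) <-> psd G /\ \tr G = 1.
  have quadE (c : 'rV_r.+1) : (mxvec G *m (mxvec (c^T *m c))^T) 0 0 = (c *m G *m c^T) 0 0.
    by rewrite mxvec_dot trmx_mul trmxK mulmxA mxtrace_mulC mxtrace_mx11 mulmxA.
  split=> [SG|[[symG posG] trG] a b].
    have symG : G^T = G.
      (* Testing [G] against its own antisymmetric defect [N] gives [\tr (N *m N^T) = - 2 * \tr (G
         *m N^T) <= 0], so [N] is 0. *)
      pose N := G^T - G; have NT : N^T = - N by rewrite linearB /= trmxK opprB.
      have := SG (mxvec N)^T 0 (Or42 _ _ _ (ex_intro2 _ _ N NT (conj erefl erefl))).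
      have GN : \tr (G^T *m N^T) = - \tr (G *m N^T).
        by rewrite -trmx_mul mxtrace_tr mxtrace_mulC NT mulmxN linearN opprK.
      have : \tr (N *m N^T) = \tr (G^T *m N^T) - \tr (G *m N^T).
        by rewrite {1}/N mulmxBl linearB.
      rewrite mxvec_dot GN => NN H; apply/eqP; rewrite -subr_eq0; apply/eqP.
      by apply: mxtrace_gram_eq0; have := mxtrace_gram_ge0 N; rewrite -/N; lra.
    split; first split=> // c.
      by rewrite -quadE; apply: SG; apply: Or41; exists c.
    have := SG _ _ (Or43 _ _ _ (conj erefl erefl)).
    have := SG _ _ (Or44 _ _ _ (conj erefl erefl)).
    rewrite !mxvec_dot linearN /= trmx1 mulmxN mulmx1 linearN /=; lra.
  case=> [[c -> ->]|[A A' [-> ->]]|[-> ->]|[-> ->]].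
  - by rewrite quadE.
  - rewrite mxvec_dot.
    have : \tr (G *m A^T) = - \tr (G *m A^T).
      rewrite {1}A' mulmxN linearN /=; congr (- _).
      by rewrite -mxtrace_tr trmx_mul symG mxtrace_mulC.
    lra.
  - by rewrite mxvec_dot trmx1 mulmx1 trG.
  - by rewrite mxvec_dot linearN /= trmx1 mulmxN mulmx1 linearN /= trG.
(* These normalized rank-one points show that the slice is nonempty, and later that [B] is positive
   definite. *)
have rank1S (c : 'rV[R]_r.+1) : c != 0 -> S (mxvec ((\tr (c *m c^T))^-1 *: (c^T *m c))).
  move=> c0; set d := \tr _.
  have d0 : 0 < d.
    rewrite lt_def mxtrace_gram_ge0 andbT; apply: contra_neq c0.
    exact: mxtrace_gram_eq0.
  apply/SE; split; first split=> [|e].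
  - by rewrite linearZ /= trmx_mul trmxK.
  - rewrite -scalemxAr -scalemxAl mxE mulr_ge0 ?invr_ge0 ?(ltW d0) //.
    have := mxtrace_gram_ge0 (e *m c^T).
    by rewrite mxtrace_mx11 trmx_mul trmxK !mulmxA.
  - by rewrite linearZ /= mxtrace_mulC -/d mulVf // gt_eqF.
(* Multiplication by [cokermx M] is the quotient by [U], so a separating vector on the quotient
   yields a functional that vanishes on [U]. *)
have [|||y posy] := @halfspaces_separation R _ _ F (cokermx M)
   (mxvec ((\tr (delta_mx 0 0 *m (delta_mx 0 0 : 'rV[R]_r.+1)^T))^-1
      *: ((delta_mx 0 0 : 'rV[R]_r.+1)^T *m delta_mx 0 0))).
- apply: rank1S; apply/eqP => /rowP/(_ 0); rewrite !mxE eqxx => /eqP.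
  by rewrite oner_eq0.
- move=> x; rewrite -[x]vec_mxK => /SE; move: (vec_mx x) => G [[symG posG] trG] k.
  pose e i : 'rV[R]_r.+1 := delta_mx 0 i.
  have entry i j : (e i *m G *m (e j)^T) 0 0 = G i j.
    by rewrite -rowE trmx_delta -colE !mxE.
  have dG i : 0 <= G i i by rewrite -entry.
  have dG1 i : G i i <= 1.
    by rewrite -trG /mxtrace (bigD1 i) //= lerDl sumr_ge0.
  case/mxvec_indexP: k => i j; rewrite mxvecE ler_norml.
  (* The two signs together bound twice the absolute value of [G i j] by [G i i + G j j], which is
     at most 2. *)
  have := posG (e i + e j); have := posG (e i - e j).
  have Gji : G j i = G i j by rewrite -[in LHS]symG mxE.
  have trD : (e i + e j)^T = (e i)^T + (e j)^T by rewrite linearD.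
  have trB : (e i - e j)^T = (e i)^T - (e j)^T by rewrite linearB.
  have -> : ((e i + e j) *m G *m (e i + e j)^T) 0 0 = G i i + G i j + (G j i + G j j).
    by rewrite -!entry trD mulmxDr !mulmxDl !mxE; ring.
  have -> : ((e i - e j) *m G *m (e i - e j)^T) 0 0 = G i i - G i j - (G j i - G j j).
    by rewrite -!entry trB mulmxBr !mulmxBl !mxE; ring.
  have := dG1 i; have := dG1 j; rewrite Gji; lra.
- move=> x; rewrite -[x]vec_mxK => /SE; rewrite vec_mxK => -[psdx trx].
  apply/negP; rewrite -submxE => /UM; have [A AE] := psd_factor psdx.
  rewrite AE => /Upsd A0; move: trx; rewrite AE A0 mulmx0 linear0 => /eqP.
  by rewrite eq_sym oner_eq0.
(* [B0] represents the functional for the trace pairing. Its symmetrization [B] still vanishes on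
   [U] because [U] is stable under transposition. *)
pose B0 := vec_mx (cokermx M *m y)^T; pose B := B0 + B0^T.
have dotB G : (mxvec G *m cokermx M *m y) 0 0 = \tr (G *m B0^T).
  by rewrite -mxvec_dot /B0 vec_mxK trmxK -mulmxA.
have UB0 G : U G -> \tr (G *m B0^T) = 0.
  move=> UG; rewrite -dotB.
  have : (mxvec G <= M)%MS by apply/UM; rewrite mxvecK.
  by rewrite submxE => /eqP ->; rewrite mul0mx mxE.
have UB G : U G -> \tr (G *m B) = 0.
  move=> UG; rewrite mulmxDr linearD /= UB0 // addr0.
  by rewrite -mxtrace_tr trmx_mul mxtrace_mulC UB0 //; exact: Utr.
have posB (c : 'rV[R]_r.+1) : c != 0 -> 0 < (c *m B *m c^T) 0 0.
  move=> c0; have := posy _ (rank1S c c0).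
  rewrite dotB -scalemxAl linearZ /= pmulr_rgt0; last first.
    rewrite invr_gt0 lt_def mxtrace_gram_ge0 andbT; apply: contra_neq c0.
    exact: mxtrace_gram_eq0.
  have -> : \tr (c^T *m c *m B0^T) = (c *m B0^T *m c^T) 0 0.
    by rewrite -mulmxA mxtrace_mulC mxtrace_mx11.
  move=> pos.
  rewrite mulmxDr mulmxDl mxE addr_gt0 //.
  by rewrite -[_ *m _ *m _]mx11_tr !trmx_mul trmxK mulmxA.
have [|A BE] := @psd_factor R _ B.
  split=> [|c]; first by rewrite linearD /= trmxK addrC.
  by have [->|/posB/ltW//] := eqVneq c 0; rewrite !mul0mx mxE.
exists A^T; split=> [|G UG]; last first.
  by rewrite trmxK -mulmxA mxtrace_mulC -mulmxA -BE UB.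
rewrite -row_free_unit -kermx_eq0; apply/rowV0P => c /sub_kermxP cA.
apply/eqP; apply: contraTT isT => /posB.
by rewrite BE mulmxA cA !mul0mx mxE ltxx.
Qed.

(** * Extending a pair of formally adjoint partial maps *)

Lemma gram_unitmx (R : realFieldType) m n (B : 'M[R]_(m, n)) :
  row_free B -> B *m B^T \in unitmx.
Proof.
move=> freeB; rewrite -row_free_unit -kermx_eq0; apply/rowV0P => c /sub_kermxP cB.
apply: (row_free_inj freeB); rewrite mul0mx; apply: mxtrace_gram_eq0.
by rewrite trmx_mul mulmxA -[_ *m B *m _]mulmxA cB mul0mx linear0.
Qed.

(** The kernel conditions make [y *m A |-> y *m C] and [y *m A |-> y *m D] well defined on the row
    space of [A]; the identity says that these partial maps are formally adjoint. *)
Lemma adjoint_extension (R : realFieldType) m r (A C D : 'M[R]_(m, r)) :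
  (forall y : 'rV_m, y *m A = 0 -> y *m C = 0) ->
  (forall y : 'rV_m, y *m A = 0 -> y *m D = 0) ->
  C *m A^T = A *m D^T ->
  exists X : 'M[R]_r, A *m X = C /\ A *m X^T = D.
Proof.
move=> kerC kerD CA.
pose B := row_base A; pose F := col_base A.
have FB : F *m B = A by exact: mulmx_base.
have /submxP[P BE] : (B <= A)%MS by rewrite eq_row_base.
(* A partial map on the row space of [A] is determined by its values on the basis [B = P *m A]. This
   reduces the problem to independent rows. *)
have factor (Z : 'M_(m, r)) : (forall y : 'rV_m, y *m A = 0 -> y *m Z = 0) ->
    F *m (P *m Z) = Z.
  move=> kerZ; apply/eqP; rewrite -subr_eq0 mulmxA -{2}[Z]mul1mx -mulmxBl.
  apply/eqP/row_matrixP => i; rewrite row_mul row0; apply: kerZ.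
  by rewrite -row_mul mulmxBl mul1mx -mulmxA -BE FB subrr row0.
have CB : P *m C *m B^T = B *m (P *m D)^T.
  by rewrite BE !trmx_mul -!mulmxA (mulmxA C) CA !mulmxA.
have [Bp BBp] : exists Bp, B *m Bp = 1%:M.
  by exists (B^T *m invmx (B *m B^T)); rewrite mulmxA mulmxV ?gram_unitmx ?row_base_free.
(* With [Pi := Bp B] the projection onto the row space of [B], [X] is prescribed on the range
   of [Pi]; its second summand vanishes there and corrects [X^T]. *)
pose X := Bp *m (P *m C) + (1%:M - Bp *m B) *m (P *m D)^T *m Bp^T.
have BX : B *m X = P *m C.
  rewrite mulmxDr (mulmxA B Bp) BBp mul1mx -[_ *m _ *m Bp^T]mulmxA (mulmxA B).
  rewrite mulmxBr mulmx1 (mulmxA B Bp) BBp mul1mx.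
  by rewrite subrr mul0mx addr0.
have BXT : B *m X^T = P *m D.
  have -> : X^T = (P *m C)^T *m Bp^T + Bp *m (P *m D *m (1%:M - B^T *m Bp^T)).
    rewrite [LHS]linearD /= (trmx_mul Bp) (trmx_mul _ Bp^T) (trmx_mul _ (P *m D)^T).
    by rewrite !trmxK linearB /= trmx1 (trmx_mul Bp).
  rewrite mulmxDr (mulmxA B Bp) BBp mul1mx mulmxBr mulmx1 !(mulmxA _ _ Bp^T).
  have -> : B *m (P *m C)^T = P *m D *m B^T.
    by rewrite -[LHS]trmxK trmx_mul trmxK CB trmx_mul trmxK.
  by rewrite addrC subrK.
by exists X; split; rewrite -[A in LHS]FB -mulmxA (BX, BXT) factor.
Qed.

(** * Left submodules of a free module over a *-algebra *)

Section star_algebra.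
Variables (R : realType) (P : nzRingType).
Variables (star : {additive P -> P}) (cst : {rmorphism R -> P}).
Hypotheses (starM : forall p q, star (p * q) = star q * star p).
Hypotheses (starK : involutive star) (starC : forall c, star (cst c) = cst c).
Hypothesis cst_comm : forall c p, cst c * p = p * cst c.

(** For [star := ncpoly_star] this is [ncmx_star] by conversion. *)
Definition mxstar a b (M : 'M[P]_(a, b)) : 'M[P]_(b, a) := map_mx star M^T.
Local Notation "A ^f" := (map_mx cst A) : ring_scope.

Lemma mxstarE a b (M : 'M[P]_(a, b)) i j : mxstar M i j = star (M j i).
Proof. by rewrite !mxE. Qed.

Lemma mxstarD a b (M N : 'M[P]_(a, b)) : mxstar (M + N) = mxstar M + mxstar N.
Proof. by apply/matrixP => i j; rewrite !mxE raddfD. Qed.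

Lemma mxstarN a b (M : 'M[P]_(a, b)) : mxstar (- M) = - mxstar M.
Proof. by apply/matrixP => i j; rewrite !mxE raddfN. Qed.

Lemma mxstar0 a b : mxstar (0 : 'M[P]_(a, b)) = 0.
Proof. by apply/matrixP => i j; rewrite !mxE raddf0. Qed.

Lemma mxstarM a b c (M : 'M[P]_(a, b)) (N : 'M[P]_(b, c)) :
  mxstar (M *m N) = mxstar N *m mxstar M.
Proof.
apply/matrixP => i j; rewrite !mxE raddf_sum; apply: eq_bigr => k _.
by rewrite /= starM !mxE.
Qed.

Lemma mxstarK a b (M : 'M[P]_(a, b)) : mxstar (mxstar M) = M.
Proof. by apply/matrixP => i j; rewrite !mxE starK. Qed.

Lemma mxstar_scalar n p : mxstar (p%:M : 'M_n) = (star p)%:M.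
Proof. by apply/matrixP => i j; rewrite !mxE eq_sym raddfMn. Qed.

Lemma mxstar_cst a b (A : 'M[R]_(a, b)) : mxstar A^f = A^T^f.
Proof. by apply/matrixP => i j; rewrite !mxE starC. Qed.

Lemma cst_mx_scalarC a b (A : 'M[R]_(a, b)) p : A^f *m p%:M = p%:M *m A^f.
Proof.
apply/matrixP => i j; rewrite mul_scalar_mx !mxE (bigD1 j) //= big1 => [|k kj].
  by rewrite !mxE eqxx addr0 mulr1n cst_comm.
by rewrite !mxE (negbTE kj) mulr0.
Qed.

Lemma scalar_cst_mxC a b (c : R) (M : 'M[P]_(a, b)) : c%:M^f *m M = M *m c%:M^f.
Proof.
rewrite !map_scalar_mx; apply/matrixP => i j; rewrite mul_scalar_mx !mxE.
rewrite (bigD1 j) //= big1 => [|k kj]; last by rewrite !mxE (negbTE kj) mulr0.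
by rewrite !mxE eqxx addr0 mulr1n cst_comm.
Qed.

(** * Quadratic forms modulo a left submodule *)

Section left_submodule.
Variables (l : nat) (I : set 'rV[P]_l).
Hypotheses (I0 : I 0) (ID : forall u v, I u -> I v -> I (u + v)).
Hypothesis IZ : forall a u, I u -> I (a *: u).

Definition mem_rows n (M : 'M[P]_(n, l)) := forall i, I (row i M).

Lemma mem_rowsD n (M N : 'M[P]_(n, l)) : mem_rows M -> mem_rows N -> mem_rows (M + N).
Proof. by move=> IM IN i; rewrite linearD /=; exact: ID. Qed.

Lemma mem_rowsM m n (A : 'M[P]_(m, n)) (M : 'M[P]_(n, l)) :
  mem_rows M -> mem_rows (A *m M).
Proof.
move=> IM i; rewrite row_mul mulmx_sum_row.
by apply: (big_ind I) => // j _; exact: IZ.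
Qed.

Lemma mem_rows0 n : mem_rows (0 : 'M[P]_(n, l)).
Proof. by move=> i; rewrite row0. Qed.

Lemma mem_rowsN n (M : 'M[P]_(n, l)) : mem_rows M -> mem_rows (- M).
Proof. by move=> IM; rewrite -[M]mul1mx -mulNmx; exact: mem_rowsM. Qed.

Lemma mem_rows_rV (u : 'rV[P]_l) : mem_rows u <-> I u.
Proof.
have rowu i : row i u = u by apply/rowP => j; rewrite mxE ord1.
by split=> [/(_ 0)|Iu i]; rewrite rowu.
Qed.

(** Working form of [sym_part], with the span on the starred side replaced by the star of a single
    matrix with rows in [I]. *)
Definition sym_sum (h : 'M[P]_l) :=
  exists M N, [/\ mem_rows M, mem_rows N & h = M + mxstar N].

Lemma symD h h' : sym_sum h -> sym_sum h' -> sym_sum (h + h').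
Proof.
move=> [A [B [IA IB ->]]] [A' [B' [IA' IB' ->]]].
exists (A + A'), (B + B'); split; [exact: mem_rowsD..|].
by rewrite mxstarD addrACA.
Qed.

Lemma sym_star h : sym_sum h -> sym_sum (mxstar h).
Proof.
move=> [A [B [IA IB ->]]]; exists B, A; split=> //.
by rewrite mxstarD mxstarK addrC.
Qed.

Lemma sym_rows h : mem_rows h -> sym_sum h.
Proof.
move=> Ih; exists h, 0; split=> //; first exact: mem_rows0.
by rewrite mxstar0 addr0.
Qed.

Lemma sym_scale (c : R) h : sym_sum h -> sym_sum (c%:M^f *m h).
Proof.
move=> [A [B [IA IB ->]]]; exists (c%:M^f *m A), (c%:M^f *m B).
split; [exact: mem_rowsM..|].
by rewrite mxstarM mxstar_cst tr_scalar_mx -scalar_cst_mxC mulmxDr.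
Qed.

(** The rows of [A] are vectors representing the rows of [t] modulo [I], and
    [G |-> \tr (A^T *m G *m A)] is the separating functional on forms. It comes from
    [psd_separation] applied to a family [b] that is a basis of the span of [t] modulo [I]. *)
Lemma gram_embedding N (t : 'M[P]_(N, l)) :
  (forall m (S : 'M[P]_(m, l)), sym_sum (mxstar S *m S) -> mem_rows S) ->
  exists r (A : 'M[R]_(N, r)),
    (forall c : 'rV_N, I (c^f *m t) <-> c *m A = 0) /\
    (forall G : 'M_N, sym_sum (mxstar t *m G^f *m t) -> \tr (A^T *m G *m A) = 0).
Proof.
move=> realI.
have [||M MP] := @subspace_row_space R N (fun c => I (c^f *m t)).
- by rewrite map_mx0 mul0mx.
- move=> a u v Iu Iv; rewrite map_mxD mulmxDl; apply: ID => //.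
  rewrite -mul_scalar_mx map_mxM -mulmxA; apply/mem_rows_rV/mem_rowsM.
  exact/mem_rows_rV.
pose E := row_base (M^C)%MS.
(* [F] gives the coordinates, in the basis [E] of a complement, of the unit rows modulo the
   relations [M]. *)
have [F FE] : exists F : 'M_(N, _), (1%:M - F *m E <= M)%MS.
  have /sub_addsmxP[[x y] /= Exy] : (1%:M <= M + M^C)%MS.
    by rewrite submx_full // addsmx_compl_full.
  have /submxP[Z ZE] : (M^C <= E)%MS by rewrite eq_row_base.
  by exists (y *m Z); rewrite -mulmxA -ZE Exy addrK; exact: submxMl.
pose b := E^f *m t.
have indep c : I (c^f *m b) -> c = 0.
  rewrite mulmxA -map_mxM => /MP cM.
  have : (c *m E <= M :&: M^C)%MS.
    rewrite sub_capmx cM /=; apply: submx_trans (submxMl _ _) _.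
    by rewrite eq_row_base.
  rewrite capmx_compl submx0 => /eqP cE0.
  by apply: (row_free_inj (row_base_free (M^C)%MS)); rewrite mul0mx.
have [z Iz tE] : exists2 z, mem_rows z & F^f *m b = t - z.
  exists (t - F^f *m b) => [i|]; last by rewrite opprB addrC subrK.
  rewrite mulmxA -map_mxM -[X in X - _]mul1mx -(map_mx1 cst).
  rewrite -mulmxBl -map_mxB row_mul -map_row.
  by apply/MP; apply: submx_trans (row_sub _ _) FE.
pose U (G : 'M[R]_(\rank (M^C)%MS)) := sym_sum (mxstar b *m G^f *m b).
have [||||A0 [unitA0 A0U]] := @psd_separation R _ U.
- by apply: sym_rows; rewrite map_mx0 mulmx0 mul0mx; exact: mem_rows0.
- move=> a G H UG UH; rewrite /U map_mxD mulmxDr mulmxDl; apply: symD => //.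
  rewrite -mul_scalar_mx map_mxM mulmxA -scalar_cst_mxC -!mulmxA.
  by apply: sym_scale; move: UG; rewrite /U -mulmxA.
- move=> G /sym_star; rewrite /U (mxstarM _ b) (mxstarM (mxstar b)) mxstarK mxstar_cst.
  by rewrite mulmxA.
(* The form of [A^T *m A] is the square of [A^f *m b], so realness puts these rows in [I], and
   independence of [b] modulo [I] makes [A] vanish. *)
- move=> A; rewrite /U map_mxM -mxstar_cst mulmxA -mxstarM -mulmxA.
  move=> /realI IA; apply/row_matrixP => i; rewrite row0; apply: indep.
  by have := IA i; rewrite row_mul map_row.
exists _, (F *m A0); split=> [c|G IG].
  have Icz : I (c^f *m z) by apply/mem_rows_rV/mem_rowsM.
  have Icz' : I (- (c^f *m z)) by apply/mem_rows_rV/mem_rowsN/mem_rows_rV.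
  have E1 : (c *m F)^f *m b = c^f *m t - c^f *m z by rewrite map_mxM -mulmxA tE mulmxBr.
  have {}E1 : I (c^f *m t) <-> I ((c *m F)^f *m b).
    split=> H; first by rewrite E1; exact: ID.
    by rewrite -[c^f *m t](subrK (c^f *m z)) -E1; exact: ID.
  apply: iff_trans E1 _; split=> [/indep cF|]; first by rewrite mulmxA cF mul0mx.
  rewrite mulmxA => cFA; have -> : c *m F = 0.
    by rewrite -[c *m F](mulmxK unitA0) cFA mul0mx.
  by rewrite map_mx0 mul0mx.
have -> : (F *m A0)^T *m G *m (F *m A0) = A0^T *m (F^T *m G *m F) *m A0.
  by rewrite trmx_mul !mulmxA.
apply: A0U; rewrite /U.
have -> : mxstar b *m (F^T *m G *m F)^f *m b = mxstar (t - z) *m G^f *m (t - z).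
  by rewrite -tE mxstarM mxstar_cst !map_mxM !mulmxA.
(* Both error terms are a matrix times [z] or the star of one; since the rows of [z] lie in [I],
   they do not affect membership in [sym_sum]. *)
have -> : mxstar (t - z) *m G^f *m (t - z) =
    mxstar t *m G^f *m t - mxstar t *m G^f *m z - mxstar (mxstar (t - z) *m G^T^f *m z).
  rewrite !mxstarM mxstarK mxstar_cst trmxK mxstarD mxstarN.
  rewrite !mulmxA !mulmxBl [X in X - _ = _]mulmxBr [X in _ - X = _]mulmxBr mulmxBr.
  by rewrite opprD addrACA -opprD.
apply: symD; first by apply: symD => //; apply/sym_rows/mem_rowsN/mem_rowsM.
by rewrite -mxstarN; apply/sym_star/sym_rows/mem_rowsN/mem_rowsM.
Qed.

(** [D] keeps the rows of [t] whose product with [p] is still expressed through [t]; [S] and [S']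
    are multiplication by [p] and [star p] on them. Stability of [I] makes both well defined on the
    vectors [A], and [symA] makes them formally adjoint. *)
Lemma compressed_multiplication N r (t : 'M[P]_(N, l)) (A : 'M[R]_(N, r))
    (D S S' : 'M[R]_N) (p : P) :
  (forall c : 'rV_N, I (c^f *m t) <-> c *m A = 0) ->
  (forall G : 'M_N, sym_sum (mxstar t *m G^f *m t) -> \tr (A^T *m G *m A) = 0) ->
  S^f *m t = p%:M *m (D^f *m t) -> S'^f *m t = (star p)%:M *m (D^f *m t) ->
  exists X : 'M[R]_r, D *m A *m X = S *m A /\ D *m A *m X^T = S' *m A.
Proof.
move=> IA symA St S't.
have ker T q : T^f *m t = q%:M *m (D^f *m t) ->
    forall y : 'rV_N, y *m (D *m A) = 0 -> y *m (T *m A) = 0.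
  move=> Tt y; rewrite !mulmxA => /IA IyD; apply/IA.
  rewrite map_mxM -mulmxA Tt mulmxA cst_mx_scalarC -mulmxA mulmxA.
  rewrite -mulmxA (mulmxA y^f) -map_mxM mul_scalar_mx; exact: IZ.
apply: adjoint_extension; [exact: ker St | exact: ker S't |].
(* The defect of adjointness is orthogonal to every [G], hence to itself: moving [p] across the star
   makes the form tested by [symA] identically 0. *)
pose Z := S *m A *m (D *m A)^T - D *m A *m (S' *m A)^T.
have trZ (G : 'M_N) : \tr (G *m Z) = 0.
  have -> : \tr (G *m Z) = \tr (A^T *m (D^T *m G *m S - S'^T *m G *m D) *m A).
    have cyc (B C : 'M_N) : \tr (G *m (B *m A *m (C *m A)^T)) =
        \tr (A^T *m (C^T *m G *m B) *m A).
      by rewrite (mulmxA G) mxtrace_mulC trmx_mul !mulmxA.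
    by rewrite mulmxBr [LHS]linearB /= !cyc -linearB -mulmxBl -mulmxBr.
  apply: symA; suff -> : mxstar t *m (D^T *m G *m S - S'^T *m G *m D)^f *m t = 0.
    by apply: sym_rows; exact: mem_rows0.
  rewrite map_mxB mulmxBr mulmxBl !map_mxM -!mxstar_cst !mulmxA -!mxstarM.
  rewrite S't (mxstarM _%:M) mxstar_scalar starK -!mulmxA St !mulmxA.
  by rewrite -(mulmxA _ G^f) cst_mx_scalarC !mulmxA subrr.
apply/eqP; rewrite -subr_eq0 -/Z -(trmxK Z) (mxtrace_gram_eq0 (A := Z^T)) ?trmx0 //.
by rewrite trmxK trZ.
Qed.

End left_submodule.
End star_algebra.

From mathcomp.finmap Require Import finmap.
From mathcomp.multinomials Require Import monalg.
From mathcomp.real_closed Require Import mxtens.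

(** * Non-commutative polynomials *)

Lemma word_starM g (w1 w2 : word g) :
  word_star (mmul w1 w2) = mmul (word_star w2) (word_star w1).
Proof. by apply/eqP; rewrite fmP /word_star !fmM map_cat rev_cat. Qed.

Lemma word_starK g : involutive (@word_star g).
Proof.
move=> w; apply/eqP; rewrite fmP /word_star /= map_rev revK -map_comp.
by rewrite map_id_in // => -[i b] _ /=; rewrite negbK.
Qed.

Lemma word_star1 g : word_star (mone : word g) = mone.
Proof. by apply/eqP; rewrite fmP /word_star !fm1. Qed.

Section star.
Variables (R : realType) (g : nat).
Local Notation P := (ncpoly R g).
Local Notation star := (@ncpoly_star R g).

(** Writing the involution as an [mmap] gives its additivity, although the support in its definition
    varies with [p]. *)
Lemma ncpoly_star_mmap (p : P) :
  star p = mmap (@malgC (word g) R) (fun w => << word_star w >>) p.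
Proof.
by rewrite mmapE; apply: eq_bigr => w _; rewrite malgM_def fgmulUU mul1m mulr1.
Qed.

Lemma ncpoly_star_is_additive : additive star.
Proof. by move=> p q; rewrite !ncpoly_star_mmap raddfB. Qed.

HB.instance Definition _ := GRing.isAdditive.Build P P star ncpoly_star_is_additive.

Lemma ncpoly_star_sum I (r : seq I) (F : I -> P) :
  star (\sum_(i <- r) F i) = \sum_(i <- r) star (F i).
Proof. exact: raddf_sum. Qed.

Lemma ncpoly_starU c w : star << c *g w >> = << c *g word_star w >>.
Proof. by rewrite ncpoly_star_mmap mmapU malgM_def fgmulUU mul1m mulr1. Qed.

Lemma ncpoly_starC (c : R) : star c%:MP = c%:MP.
Proof. by rewrite ncpoly_starU word_star1. Qed.

Lemma ncpoly_starM (p q : P) : star (p * q) = star q * star p.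
Proof.
rewrite (monalgE p) mulr_suml !raddf_sum mulr_sumr; apply: eq_bigr => w _ /=.
rewrite (monalgE q) mulr_sumr !raddf_sum mulr_suml; apply: eq_bigr => w' _ /=.
by rewrite malgM_def fgmulUU !ncpoly_starU malgM_def fgmulUU word_starM mulrC.
Qed.

Lemma ncpoly_starK : involutive star.
Proof.
move=> p; transitivity (star (star (\sum_(w <- msupp p) << p@_w *g w >>))).
  by rewrite -monalgE.
rewrite [RHS]monalgE !ncpoly_star_sum.
by apply: eq_bigr => w _; rewrite !ncpoly_starU word_starK.
Qed.

Lemma malgC_comm (c : R) (p : P) : c%:MP * p = p * c%:MP.
Proof.
rewrite mul_malgC (monalgE p) mulr_suml scaler_sumr; apply: eq_bigr => w _.
by rewrite malgM_def fgmulUU mulm1 -mul_malgC malgM_def fgmulUU mul1m mulrC.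
Qed.

Lemma mxstar_ncE a b (M : 'M[P]_(a, b)) : ncmx_star M = mxstar star M.
Proof. by []. Qed.

Section left_module.
Variables (l : nat) (I : set 'rV[P]_l).
Hypothesis modI : left_module I.
Let I0 : I 0. Proof. by case: modI. Qed.
Let ID u v : I u -> I v -> I (u + v). Proof. by case: modI => _ + _; apply. Qed.
Let IZ a u : I u -> I (a *: u). Proof. by case: modI => _ _; apply. Qed.
Local Notation cst := (@malgC (word g) R : {rmorphism R -> P}).

Lemma scale_ncmxE a b (c : R) (M : 'M[P]_(a, b)) :
  map_mx ( *:%R c) M = map_mx cst c%:M *m M.
Proof.
rewrite map_scalar_mx mul_scalar_mx; apply/matrixP => i j.
by rewrite [LHS]mxE [RHS]mxE mul_malgC.
Qed.

Lemma sym_partP (h : 'M[P]_l) : sym_part I h <-> sym_sum star I h.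
Proof.
split=> [[M IM [N [m [c [s [sE ->]]]] <-]]|[M [N [IM IN ->]]]].
  exists M, (mxstar star (\sum_i map_mx ( *:%R (c i)) (s i))).
  split=> //; last by rewrite (mxstarK ncpoly_starK).
  apply: (big_ind (fun h => mem_rows I (mxstar star h))) => [|A B IA IB|i _].
  - by rewrite mxstar0; exact: mem_rows0.
  - by rewrite mxstarD; exact: mem_rowsD.
  have [x [u Iu <-] [y [A _ <-] <-]] := sE i.
  rewrite scale_ncmxE mulmxA (scalar_cst_mxC malgC_comm) -mulmxA -map_mxM.
  rewrite (mxstarM ncpoly_starM) mxstar_ncE (mxstarK ncpoly_starK).
  by apply: mem_rowsM => //; exact/mem_rows_rV.
exists M => //; exists (mxstar star N) => //.
(* Column [j] of the star of [N] is the star of row [j] of [N], placed there by the [j]-th unit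
   row. *)
exists l, (fun=> 1), (fun j => mxstar star (row j N) *m map_mx cst (delta_mx 0 j)); split.
  move=> j; exists (mxstar star (row j N)); first by exists (row j N).
  by exists (map_mx cst (delta_mx 0 j)) => //; exists (delta_mx 0 j).
apply/matrixP => a b; rewrite summxE (bigD1 b) //= big1 => [|j jb].
  rewrite addr0 scale_ncmxE map_mx1 mul1mx [RHS]mxE big_ord1 !mxstarE.
  by rewrite [row _ _ _ _]mxE map_delta_mx [delta_mx _ _ _ _]mxE !eqxx mulr1.
rewrite scale_ncmxE map_mx1 mul1mx mxE big_ord1.
by rewrite map_delta_mx [delta_mx _ _ _ _]mxE (eq_sym b) (negbTE jb) mulr0.
Qed.

End left_module.

(** The sum of squares of the rows of [S] is the single product [mxstar star S *m S]. *)
Lemma real_module_gram l (I : set 'rV[P]_l) : real_module I ->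
  forall m (S : 'M[P]_(m, l)), sym_sum star I (mxstar star S *m S) -> mem_rows I S.
Proof.
move=> [modI realI] m S IS i; apply: (realI m (fun i => row i S)).
suff -> : \sum_i ncmx_star (row i S) *m row i S = mxstar star S *m S by exact/sym_partP.
apply/matrixP => a b; rewrite summxE mxE; apply: eq_bigr => k _.
by rewrite [LHS]mxE big_ord1 mxstar_ncE !mxstarE [row _ _ _ _]mxE [X in _ * X = _]mxE.
Qed.

End star.

(** * Evaluation *)

Section evaluation.
Variables (R : realType) (g n : nat) (X : 'I_g -> 'M[R]_n).
Local Notation P := (ncpoly R g).
Local Notation star := (@ncpoly_star R g).

Definition letter_eval (c : 'I_g * bool) := if c.2 then (X c.1)^T else X c.1.

Lemma word_eval_nil : word_eval X (FMonom [::]) = 1%:M.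
Proof. by rewrite /word_eval big_nil. Qed.

Lemma word_eval_cons c s :
  word_eval X (FMonom (c :: s)) = letter_eval c *m word_eval X (FMonom s).
Proof. by rewrite /word_eval big_cons. Qed.

Lemma word_eval_cat s1 s2 :
  word_eval X (FMonom (s1 ++ s2)) =
  word_eval X (FMonom s1) *m word_eval X (FMonom s2).
Proof.
elim: s1 => [|c s1 IHs]; first by rewrite word_eval_nil mul1mx.
by rewrite cat_cons !word_eval_cons IHs mulmxA.
Qed.

Lemma word_evalM (w1 w2 : word g) :
  word_eval X (mmul w1 w2) = word_eval X w1 *m word_eval X w2.
Proof.
rewrite -[mmul w1 w2]fmK -[w1 in RHS]fmK -[w2 in RHS]fmK -word_eval_cat.
by congr (word_eval X (FMonom _)); exact: fmM.
Qed.

Lemma word_eval_star (w : word g) : word_eval X (word_star w) = (word_eval X w)^T.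
Proof.
rewrite -[w in RHS]fmK /word_star; elim: (w : seq _) => [|[i b] s IHs].
  by rewrite word_eval_nil trmx1.
rewrite /= rev_cons -cats1 word_eval_cat IHs word_eval_cons word_eval_nil mulmx1.
by rewrite word_eval_cons trmx_mul /letter_eval; case: b; rewrite /= ?trmxK.
Qed.

Definition ncpoly_eval (f : P) : 'M[R]_n :=
  \sum_(w <- msupp f) f@_w *: word_eval X w.

Lemma ncpoly_evalE f i j :
  ncpoly_eval f i j = mmap idfun (fun w => word_eval X w i j) f.
Proof. by rewrite summxE mmapE; apply: eq_bigr => w _; rewrite mxE. Qed.

Lemma ncpoly_eval_is_additive : additive ncpoly_eval.
Proof. by move=> p q; apply/matrixP => i j; rewrite !mxE !ncpoly_evalE raddfB. Qed.

HB.instance Definition _ :=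
  GRing.isAdditive.Build P 'M[R]_n ncpoly_eval ncpoly_eval_is_additive.

Lemma ncpoly_eval_sum I (r : seq I) (F : I -> P) :
  ncpoly_eval (\sum_(i <- r) F i) = \sum_(i <- r) ncpoly_eval (F i).
Proof. exact: raddf_sum. Qed.

Lemma ncpoly_evalD : {morph ncpoly_eval : p q / p + q}.
Proof. exact: raddfD. Qed.

Lemma ncpoly_evalU c w : ncpoly_eval << c *g w >> = c *: word_eval X w.
Proof. by apply/matrixP => i j; rewrite ncpoly_evalE mmapU mxE. Qed.

Lemma ncpoly_evalM (p q : P) : ncpoly_eval (p * q) = ncpoly_eval p *m ncpoly_eval q.
Proof.
rewrite (monalgE p) mulr_suml !ncpoly_eval_sum mulmx_suml; apply: eq_bigr => w _.
rewrite (monalgE q) mulr_sumr !ncpoly_eval_sum mulmx_sumr; apply: eq_bigr => w' _.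
rewrite malgM_def fgmulUU !ncpoly_evalU word_evalM.
by rewrite -scalemxAl -scalemxAr scalerA.
Qed.

Lemma ncpoly_eval_star (p : P) : ncpoly_eval (star p) = (ncpoly_eval p)^T.
Proof.
rewrite (monalgE p) ncpoly_star_sum !ncpoly_eval_sum [RHS]linear_sum.
apply: eq_bigr => w _; rewrite ncpoly_starU !ncpoly_evalU word_eval_star.
by rewrite [RHS]linearZ.
Qed.

Lemma ncmx_evalE a b (p : 'M[P]_(a, b)) i j s t :
  ncmx_eval X p (mxtens_index (i, s)) (mxtens_index (j, t)) =
  ncpoly_eval (p i j) s t.
Proof.
rewrite summxE ncpoly_evalE mmapE.
under eq_bigr do rewrite tensmxE mxE.
rewrite [RHS](big_fset_incl _ (B := ncmx_supp p)) //.
  apply/fsubsetP => w wp; rewrite /ncmx_supp.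
  apply/bigfcupP; exists i; first by rewrite mem_index_enum.
  by apply/bigfcupP; exists j; first by rewrite mem_index_enum.
by move=> w _ /mcoeff_outdom ->; rewrite mul0r.
Qed.

(** * Rows of polynomials acting on a vector *)

Section vector.
Variables (l : nat) (v : 'cV[R]_(l * n)).

Definition vblock (j : 'I_l) : 'cV[R]_n := \col_s v (mxtens_index (j, s)) 0.

(** This is u(X)v for one row [u], computed on the [l] blocks of [v] rather than through Kronecker
    products. *)
Definition nc_act (u : 'rV[P]_l) : 'cV[R]_n :=
  \sum_j ncpoly_eval (u 0 j) *m vblock j.

Lemma ncmx_eval_act a (p : 'M[P]_(a, l)) i s :
  (ncmx_eval X p *m v) (mxtens_index (i, s)) 0 = nc_act (row i p) s 0.
Proof.
rewrite mxE summxE (reindex (@mxtens_index l n)); last first.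
  by exists (@mxtens_unindex l n) => k _; [exact: mxtens_indexK | exact: mxtens_unindexK].
transitivity (\sum_j \sum_t ncpoly_eval (p i j) s t * vblock j t 0).
  by rewrite pair_bigA; apply: eq_bigr => -[j t] _; rewrite ncmx_evalE [vblock _ _ _]mxE.
by apply: eq_bigr => j _; rewrite [RHS]mxE [row _ _ _ _]mxE.
Qed.

Lemma ncmx_eval_eq0 a (p : 'M[P]_(a, l)) :
  ncmx_eval X p *m v = 0 <-> forall i, nc_act (row i p) = 0.
Proof.
split=> [p0 i|p0].
  by apply/colP => s; rewrite -ncmx_eval_act p0 !mxE.
apply/colP => k; rewrite -[k]mxtens_unindexK; case: (mxtens_unindex k) => i s.
by rewrite ncmx_eval_act p0 !mxE.
Qed.

Lemma nc_actD u u' : nc_act (u + u') = nc_act u + nc_act u'.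
Proof.
rewrite -big_split; apply: eq_bigr => j _; rewrite [(u + u') _ _]mxE ncpoly_evalD.
exact: mulmxDl.
Qed.

Lemma nc_actZ a u : nc_act (a *: u) = ncpoly_eval a *m nc_act u.
Proof.
rewrite mulmx_sumr; apply: eq_bigr => j _.
by rewrite [(a *: u) _ _]mxE ncpoly_evalM mulmxA.
Qed.

Lemma nc_act0 : nc_act 0 = 0.
Proof.
rewrite /nc_act big1 // => j _; rewrite [(0 : 'rV_l) _ _]mxE.
by rewrite (_ : ncpoly_eval 0 = 0) ?mul0mx //; exact: raddf0.
Qed.

(** The value v^T h(X) v, kept as a 1 by 1 matrix. *)
Definition nc_form (h : 'M[P]_l) : 'M[R]_1 :=
  \sum_i (vblock i)^T *m nc_act (row i h).

Lemma nc_formE h : nc_form h =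
  \sum_i \sum_j (vblock i)^T *m ncpoly_eval (h i j) *m vblock j.
Proof.
apply: eq_bigr => i _; rewrite mulmx_sumr; apply: eq_bigr => j _.
by rewrite [row _ _ _ _]mxE mulmxA.
Qed.

Lemma nc_formD h h' : nc_form (h + h') = nc_form h + nc_form h'.
Proof.
rewrite -big_split; apply: eq_bigr => i _.
by rewrite linearD /= nc_actD mulmxDr.
Qed.

Lemma nc_form_star h : nc_form (mxstar star h) = (nc_form h)^T.
Proof.
rewrite !nc_formE exchange_big [RHS]linear_sum; apply: eq_bigr => i _.
rewrite [RHS]linear_sum; apply: eq_bigr => j _.
by rewrite mxstarE ncpoly_eval_star /= !trmx_mul trmxK mulmxA.
Qed.

Lemma nc_form_square m (S : 'M[P]_(m, l)) : nc_form (mxstar star S *m S) =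
  \sum_i (nc_act (row i S))^T *m nc_act (row i S).
Proof.
rewrite nc_formE.
transitivity (\sum_k \sum_i \sum_j (vblock i)^T *m (ncpoly_eval (S k i))^T *m
   (ncpoly_eval (S k j) *m vblock j)).
  rewrite [RHS]exchange_big; apply: eq_bigr => i _.
  rewrite [RHS]exchange_big; apply: eq_bigr => j _.
  rewrite mxE ncpoly_eval_sum mulmx_sumr mulmx_suml; apply: eq_bigr => k _.
  by rewrite ncpoly_evalM mxstarE ncpoly_eval_star !mulmxA.
apply: eq_bigr => k _.
have -> : (nc_act (row k S))^T = \sum_i (vblock i)^T *m (ncpoly_eval (S k i))^T.
  rewrite [LHS]linear_sum; apply: eq_bigr => i _.
  by rewrite /= trmx_mul [row _ _ _ _]mxE.
rewrite mulmx_suml; apply: eq_bigr => i _.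
rewrite mulmx_sumr; apply: eq_bigr => j _.
by rewrite [row _ _ _ _]mxE.
Qed.

Lemma real_module_annihilator : real_module [set u | nc_act u = 0].
Proof.
have modA : left_module [set u | nc_act u = 0].
  split=> /= [|u u' u0 u'0|a u u0]; first exact: nc_act0.
    by rewrite nc_actD u0 u'0 addr0.
  by rewrite nc_actZ u0 mulmx0.
split=> // m s sym_s i.
pose S := \matrix_k s k.
have SE : \sum_(k < m) ncmx_star (s k) *m s k = mxstar star S *m S.
  apply/matrixP => a b; rewrite summxE [RHS]mxE; apply: eq_bigr => k _.
  by rewrite [LHS]mxE big_ord1 mxstar_ncE !mxstarE !(mxE _ (fun i j => s i 0 j)).
move: sym_s; rewrite SE => /(sym_partP modA)[M [N [M0 N0 SMN]]].
have rows_form h : mem_rows [set u | nc_act u = 0] h -> nc_form h = 0.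
  by move=> h0; rewrite /nc_form big1 // => k _; rewrite (h0 k) mulmx0.
have form0 : \sum_k (nc_act (row k S))^T *m nc_act (row k S) = 0.
  (* Matrices with rows in the annihilator have form 0, and so do their stars by transposition; the
     sum of the squared norms is therefore 0. *)
  rewrite -nc_form_square SMN nc_formD nc_form_star.
  by rewrite !rows_form // trmx0 addr0.
have ge0 k : 0 <= \tr (nc_act (row k S) *m (nc_act (row k S))^T).
  exact: mxtrace_gram_ge0.
have /psumr_eq0P tr0 : \sum_k \tr (nc_act (row k S) *m (nc_act (row k S))^T) = 0.
  under eq_bigr do rewrite mxtrace_mulC.
  by rewrite -[LHS](linear_sum (@mxtrace R 1)) form0 linear0.
have := mxtrace_gram_eq0 (tr0 (fun k _ => ge0 k) i isT).
by rewrite rowK.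
Qed.

End vector.
End evaluation.

(** * The truncated GNS representation *)

Lemma row_sum_delta_scale (P : pzRingType) l (u : 'rV[P]_l) (F : 'I_l -> P) :
  (forall j, u 0 j = F j) -> \sum_j F j *: delta_mx 0 j = u.
Proof.
by move=> uF; rewrite [RHS]row_sum_delta; apply: eq_bigr => j _; rewrite uF.
Qed.

Section combinations.
Variables (R P : nzRingType) (cst : {rmorphism R -> P}) (N l : nat).
Variable t : 'M[P]_(N, l).

Lemma shift_rows_mul (q : P) (keep : pred 'I_N) (next : 'I_N -> 'I_N) :
  (forall k, keep k -> row (next k) t = q *: row k t) ->
  map_mx cst (\matrix_k if keep k then delta_mx 0 (next k) else 0) *m t =
  q%:M *m (map_mx cst (\matrix_k if keep k then delta_mx 0 k else 0) *m t).
Proof.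
move=> nextE; apply/row_matrixP => k.
rewrite mul_scalar_mx [RHS]linearZ /= !row_mul -!map_row !rowK.
case: ifP => [/nextE kE|_]; last by rewrite map_mx0 !mul0mx scaler0.
by rewrite !map_delta_mx -!rowE.
Qed.

Lemma map_mx_combination_mul J (r : seq J) K (s : J -> seq K) (c : J -> K -> R)
    (e : J -> K -> 'I_N) :
  map_mx cst (\sum_(j <- r) \sum_(w <- s j) c j w *: delta_mx 0 (e j w)) *m t =
  \sum_(j <- r) \sum_(w <- s j) cst (c j w) *: row (e j w) t.
Proof.
rewrite raddf_sum mulmx_suml; apply: eq_bigr => j _.
rewrite raddf_sum mulmx_suml; apply: eq_bigr => w _.
by rewrite /= map_mxZ map_delta_mx -scalemxAl -rowE.
Qed.

End combinations.

Section gns.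
Variables (R : realType) (g l : nat).
Local Notation P := (ncpoly R g).
Local Notation star := (@ncpoly_star R g).
Local Notation cst := (@malgC (word g) R : {rmorphism R -> P}).
Local Notation letter := ('I_g * bool)%type.

Definition nc_word (s : seq letter) : P := << (FMonom s : word g) >>.

Definition monomial_row (s : seq letter) (j : 'I_l) : 'rV[P]_l :=
  nc_word s *: delta_mx 0 j.

Lemma nc_word_cons (c : letter) s : nc_word [:: c] * nc_word s = nc_word (c :: s).
Proof.
rewrite malgM_def fgmulUU mulr1; congr << _ *g _ >>.
by apply/eqP; rewrite fmP fmM.
Qed.

Lemma nc_word_star i : star (nc_word [:: (i, false)]) = nc_word [:: (i, true)].
Proof. exact: ncpoly_starU. Qed.

Lemma scale_monomial_row c s j :
  nc_word [:: c] *: monomial_row s j = monomial_row (c :: s) j.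
Proof. by rewrite /monomial_row -(nc_word_cons c s); exact: scalerA. Qed.

Variable d : nat.
Local Notation index := (d.-bseq letter * 'I_l)%type.
Local Notation N := #|{: index}|.

(* Junk value: words longer than [d] are sent to the index of the empty word. *)
Definition mono_index (s : seq letter) (j : 'I_l) : 'I_N :=
  enum_rank (insub_bseq d s, j).
Definition mono_word (k : 'I_N) : seq letter := (enum_val k).1.
Definition mono_pos (k : 'I_N) : 'I_l := (enum_val k).2.

Lemma mono_word_index s j : (size s <= d)%N -> mono_word (mono_index s j) = s.
Proof.
move=> sd; rewrite /mono_word /mono_index enum_rankK.
change (val (insub_bseq d s) = s).
rewrite /insub_bseq /insubd; case: insubP => [u _ ->|]; first by [].
by rewrite sd.
Qed.

Lemma mono_pos_index s j : mono_pos (mono_index s j) = j.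
Proof. by rewrite /mono_pos /mono_index enum_rankK. Qed.

Definition monomials : 'M[P]_(N, l) :=
  \matrix_k monomial_row (mono_word k) (mono_pos k).

Lemma row_monomials s j :
  (size s <= d)%N -> row (mono_index s j) monomials = monomial_row s j.
Proof.
by move=> sd; rewrite /monomials rowK mono_pos_index (mono_word_index _ sd).
Qed.

(** The inequality is strict so that one more letter still gives a word of length at most [d]. This
    matrix is the [D] of [compressed_multiplication], and [shift] provides [S] and [S']. *)
Definition truncation : 'M[R]_N :=
  \matrix_k (if (size (mono_word k) < d)%N then delta_mx 0 k else 0).

Definition shift (c : letter) : 'M[R]_N :=
  \matrix_k (if (size (mono_word k) < d)%N
             then delta_mx 0 (mono_index (c :: mono_word k) (mono_pos k)) else 0).

Lemma shift_monomials c :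
  map_mx cst (shift c) *m monomials =
  (nc_word [:: c])%:M *m (map_mx cst truncation *m monomials).
Proof.
have next k : (size (mono_word k) < d)%N ->
    row (mono_index (c :: mono_word k) (mono_pos k)) monomials =
    nc_word [:: c] *: row k monomials.
  move=> kd; rewrite (row_monomials _ (s := c :: mono_word k)); last by [].
  by rewrite /monomials rowK scale_monomial_row.
exact: (shift_rows_mul cst next).
Qed.

Lemma row_truncation r (A : 'M[R]_(N, r)) s j : (size s < d)%N ->
  row (mono_index s j) (truncation *m A) = row (mono_index s j) A.
Proof.
move=> sd; rewrite row_mul rowK mono_word_index; last exact: ltnW.
by rewrite sd -rowE.
Qed.

Lemma row_shift r (A : 'M[R]_(N, r)) c s j : (size s < d)%N ->
  row (mono_index s j) (shift c *m A) = row (mono_index (c :: s) j) A.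
Proof.
move=> sd; rewrite row_mul rowK mono_word_index; last exact: ltnW.
by rewrite sd -rowE mono_pos_index.
Qed.

Definition coef_row (u : 'rV[P]_l) : 'rV[R]_N :=
  \sum_j \sum_(w <- msupp (u 0 j)) (u 0 j)@_w *: delta_mx 0 (mono_index w j).

Lemma coef_rowK (u : 'rV[P]_l) :
  (forall j w, w \in msupp (u 0 j) -> (size w <= d)%N) ->
  map_mx cst (coef_row u) *m monomials = u.
Proof.
move=> ud; apply: (etrans (map_mx_combination_mul cst monomials _ _ _ _)).
apply: (etrans _ (row_sum_delta_scale (fun j => monalgE (u 0 j)))).
apply: eq_bigr => j _; rewrite scaler_suml.
rewrite [LHS]big_seq [RHS]big_seq; apply: eq_bigr => w wu.
rewrite row_monomials; last exact: (ud j).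
rewrite /monomial_row scalerA; congr (_ *: _).
by rewrite malgM_def fgmulUU mul1m mulr1 fmK.
Qed.

(** The module of rows is replaced by its part of degree at most [d], whose classes modulo [I] are
    vectors in a finite-dimensional space. Evaluation on [v] is faithful as long as words do not
    exceed [d]. *)
Lemma gns_representation (I : set 'rV[P]_l) : real_module I ->
  exists (n : nat) (X : 'I_g -> 'M[R]_n) (v : 'cV[R]_(l * n)),
    forall u : 'rV[P]_l,
      (forall j w, w \in msupp (u 0 j) -> (size w <= d)%N) ->
      (nc_act X v u = 0 <-> I u).
Proof.
move=> realI; have [[I0 ID IZ] _] := realI.
have [n [A [IA symA]]] := gram_embedding (@ncpoly_starM R g) (@ncpoly_starK R g)
  (@ncpoly_starC R g) (@malgC_comm R g : forall c p, cst c * p = p * cst c)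
  I0 ID IZ monomials (real_module_gram realI).
have /choice[X XP] (i : 'I_g) : exists X : 'M[R]_n,
    truncation *m A *m X = shift (i, false) *m A /\
    truncation *m A *m X^T = shift (i, true) *m A.
  apply: (compressed_multiplication (@ncpoly_starM R g) (@ncpoly_starK R g)
    (@ncpoly_starC R g) (@malgC_comm R g : forall c p, cst c * p = p * cst c)
    I0 IZ (p := nc_word [:: (i, false)]) IA symA);
  first exact: shift_monomials.
  by have := shift_monomials (i, true); rewrite -nc_word_star.
(* [X] acts on row vectors from the right, whereas evaluation acts on columns, hence the
   transposes. *)
exists n, (fun i => (X i)^T).
(* Block [j] of [v] is the vector of the empty word in position [j], that is, the class of the
   [j]-th unit row. *)
pose v := \col_k A (mono_index [::] (mxtens_unindex k).1) (mxtens_unindex k).2.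
exists v => u ud.
have vE j : vblock v j = (row (mono_index [::] j) A)^T.
  by apply/colP => s; rewrite !mxE mxtens_indexK.
have letterE c s j : (size s < d)%N ->
    letter_eval (fun i => (X i)^T) c *m (row (mono_index s j) A)^T =
    (row (mono_index (c :: s) j) A)^T.
  move=> sd; rewrite -row_truncation // -row_shift // /letter_eval.
  case: c => i [] /=; have [XE XTE] := XP i.
    by rewrite -XTE [in RHS]row_mul [RHS]trmx_mul trmxK.
  by rewrite -XE [in RHS]row_mul [RHS]trmx_mul.
(* Each letter is prepended to a word of length less than [d], where the truncated multiplication is
   exact. *)
have wordE s j : (size s <= d)%N ->
    word_eval (fun i => (X i)^T) (FMonom s) *m vblock v j =
    (row (mono_index s j) A)^T.
  elim: s => [|c s IHs] sd; first by rewrite word_eval_nil mul1mx vE.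
  by rewrite word_eval_cons -mulmxA IHs ?letterE // ltnW.
have -> : nc_act (fun i => (X i)^T) v u = (coef_row u *m A)^T.
  rewrite /coef_row mulmx_suml [RHS]linear_sum; apply: eq_bigr => j _.
  rewrite /= [in RHS]mulmx_suml [RHS]linear_sum [LHS]mulmx_suml [LHS]big_seq [RHS]big_seq.
  apply: eq_bigr => w wu.
  rewrite /= -!scalemxAl -rowE [RHS]linearZ /= -wordE ?(ud j) //.
rewrite -[in X in _ <-> X](coef_rowK ud); apply: iff_trans (iff_sym (IA _)).
by split=> [/(congr1 trmx)|->]; rewrite ?trmxK trmx0.
Qed.

End gns.

(** * The module generated by the [p i] *)

Section generators.
Variables (R : realType) (g l k : nat) (nus : 'I_k -> nat).
Variable p : forall i : 'I_k, 'M[ncpoly R g]_(nus i, l).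
Local Notation P := (ncpoly R g).

(** The real coefficients of the span are absorbed into the polynomial left factors, so one product
    per generator suffices. *)
Lemma gen_moduleP (u : 'rV[P]_l) :
  gen_module p u <-> exists r : forall i, 'rV[P]_(nus i), u = \sum_i r i *m p i.
Proof.
split=> [[m [mP ->]]|[r ->]]; last first.
  exists (fun i => r i *m p i); split=> // i.
  exists 1%N, (fun=> 1), (fun=> r i *m p i); split=> [_|].
    by exists (r i) => //; exists (p i).
  by rewrite big_ord1 scale_ncmxE map_mx1 mul1mx.
have rP i : exists r, m i = r *m p i.
  have [n [c [s [sP ->]]]] := mP i.
  have /choice[x xP] j : exists x, s j = x *m p i.
    by have [x _ [_ -> <-]] := sP j; exists x.
  exists (\sum_j map_mx ( *:%R (c j)) (x j)); rewrite mulmx_suml.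
  by apply: eq_bigr => j _; rewrite !scale_ncmxE xP mulmxA.
by exists (fun i => projT1 (cid (rP i))); apply: eq_bigr => i _; case: cid.
Qed.

Lemma gen_module_row i a : gen_module p (row a (p i)).
Proof.
apply/gen_moduleP.
(* The ordinal types ['I_(nus i')] and ['I_(nus i)] differ, so [b] and [a] are compared as natural
   numbers. *)
exists (fun i' => \row_b ((i' == i) && (b == a :> nat))%:R).
rewrite (bigD1 i) //= big1 => [|i' ii'].
  rewrite addr0 rowE; congr (_ *m _); apply/rowP => b.
  by rewrite !mxE !eqxx.
rewrite (_ : \row_b _ = 0) ?mul0mx //.
by apply/matrixP => ? b; rewrite !mxE (negbTE ii').
Qed.

Lemma gen_module_sub (I : set 'rV[P]_l) :
  left_module I -> (forall i, rows_in I (p i)) -> gen_module p `<=` I.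
Proof.
move=> [I0 ID IZ] Ip u /gen_moduleP[r ->].
apply: (big_ind I) => // i _; apply/(mem_rows_rV I).
exact: (mem_rowsM I0 ID IZ (r i) (Ip i)).
Qed.

End generators.

(** * Degree bounds and the conclusion *)

Definition word_bound (R : realType) g a b (p : 'M[ncpoly R g]_(a, b)) :=
  (\max_i \max_j \max_(w <- msupp (p i j)) size w)%N.

Lemma word_boundP (R : realType) g a b (p : 'M[ncpoly R g]_(a, b)) i j w :
  w \in msupp (p i j) -> (size w <= word_bound p)%N.
Proof.
move=> wp; apply: leq_trans (leq_bigmax i); apply: leq_trans (leq_bigmax j).
exact: (leq_bigmax_seq (F := fun w : word g => size w)).
Qed.

Theorem theorem1p3 (R : realType) (g l k : nat)
    (g_gt0 : (0 < g)%N) (l_gt0 : (0 < l)%N) (k_gt0 : (0 < k)%N)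
    (nus : 'I_k -> nat) (p : forall i : 'I_k, 'M[ncpoly R g]_(nus i, l))
    (nu : nat) (q : 'M[ncpoly R g]_(nu, l)) :
  ((forall (n : nat) (X : 'I_g -> 'M[R]_n) (v : 'cV[R]_(l * n)),
      (forall i : 'I_k, ncmx_eval X (p i) *m v = 0) -> ncmx_eval X q *m v = 0)
   <-> rows_in (nu := nu) (real_radical (gen_module p)) q)
  /\
  (real_module (gen_module p) ->
   (forall (n : nat) (X : 'I_g -> 'M[R]_n) (v : 'cV[R]_(l * n)),
      (forall i : 'I_k, ncmx_eval X (p i) *m v = 0) -> ncmx_eval X q *m v = 0) ->
   exists r : forall i : 'I_k, 'M[ncpoly R g]_(nu, nus i),
     q = \sum_(i < k) r i *m p i).
Proof.
(* Common core of both claims: [J] runs over all real modules in the radical, and is the generated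
   module itself in the consequence. *)
have vanish_in J :
    (forall (n : nat) (X : 'I_g -> 'M[R]_n) (v : 'cV[R]_(l * n)),
      (forall i : 'I_k, ncmx_eval X (p i) *m v = 0) -> ncmx_eval X q *m v = 0) ->
    real_module J -> gen_module p `<=` J -> rows_in J q.
  move=> vanish realJ pJ a.
  (* The degree must cover the generators, to have them vanish at [v], as well as [q], to read off
     membership in [J]. *)
  pose d := maxn (\max_i word_bound (p i)) (word_bound q).
  have [n [X [v XvJ]]] := gns_representation d realJ.
  have /(ncmx_eval_eq0 X v q)/(_ a) : ncmx_eval X q *m v = 0.
    apply: vanish => i; apply/ncmx_eval_eq0 => b; apply/XvJ => [j w|].
      rewrite mxE => /word_boundP wb; rewrite leq_max; apply/orP; left.
      exact: leq_trans wb (leq_bigmax i).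
    exact/pJ/gen_module_row.
  move=> /XvJ; apply => j w; rewrite mxE => /word_boundP wb.
  by rewrite leq_max wb orbT.
split; [split=> [vanish a J [realJ pJ]|rr_q n X v pv]|move=> real_gen vanish].
- exact: vanish_in.
(* The annihilator of [v] is one of the real modules intersected in the radical. *)
- apply/ncmx_eval_eq0 => a; apply: (rr_q a [set u | nc_act X v u = 0]); split.
    exact: real_module_annihilator.
  have [modA _] := real_module_annihilator X v.
  by apply: gen_module_sub => // i; exact/ncmx_eval_eq0.
have rows_gen a := vanish_in _ vanish real_gen (fun _ => id) a.
have /choice[r rP] a : exists r : forall i, 'rV_(nus i), row a q = \sum_i r i *m p i.
  exact/gen_moduleP.
exists (fun i => \matrix_a r a i); apply/row_matrixP => a.
rewrite rP raddf_sum; apply: eq_bigr => i _.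
by rewrite /= row_mul rowK.
Qed.
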